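(* Let $X$ be an infinitely divisible, $\mathbb{R}^m$-valued random variable with characteristic triplet $(\gamma,\Sigma,\nu)$ and let $k$ be a positive even integer. Assume that the constants $c_i,C_i$, $i=0,1$, satisfy $$\int_{\|x\|<1}\|x\|^r\,\nu(dx)\le C_0c_0^r,\quad r=2,\ldots,k,\qquad \int_{\|x\|\ge 1}\|x\|^r\,\nu(dx)\le C_1c_1^r,\quad r=1,\ldots,k.$$ Then there exists a constant $C>0$, depending on $m$ and $k$, but not on $(\gamma,\Sigma,\nu)$, such that $$\mathbb{E}\|X\|^k\le C\left[\|\gamma\|^k+\|\Sigma\|^{k/2}+c_0^k+c_1^k\right].$$
   Context: $\|\cdot\|$ is the Euclidean norm on $\mathbb{R}^m$ and the induced operator norm on matrices. An infinitely divisible $X$ has characteristic triplet $(\gamma,\Sigma,\nu)$ ($\gamma\in\mathbb{R}^m$, $\Sigma$ a symmetric non-negative definite $m\times m$ matrix, $\nu$ a measure on $\mathbb{R}^m$ with $\nu(\{0\})=0$ and $\int\min(\|x\|^2,1)\nu(dx)<\infty$) if for all $u\in\mathbb{R}^m$ $$\mathbb{E}e^{i\langle u,X\rangle}=\exp\Big\{i\langle\gamma,u\rangle-\tfrac12\langle u,\Sigma u\rangle+\int_{\mathbb{R}^m}\big[e^{i\langle u,x\rangle}-1-i\langle u,x\rangle 1_{\{\|x\|\le 1\}}\big]\nu(dx)\Big\}.$$ *)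

(* Defs.v *)
From HB Require Import structures.
From mathcomp Require Import all_boot all_order all_algebra.
From mathcomp Require Import all_classical all_reals all_analysis.
From mathcomp Require Import complex.

Set Implicit Arguments.
Unset Strict Implicit.
Unset Printing Implicit Defensive.

Import Order.TTheory GRing.Theory Num.Theory numFieldNormedType.Exports.

Local Open Scope classical_set_scope.
Local Open Scope ring_scope.
Local Open Scope complex_scope.

(* Matrices over R, and in particular the column vectors 'cV[R]_m standing for
   R^m, carry the Borel sigma-algebra of their canonical topology. *)
HB.instance Definition _ (R : realType) (m n : nat) :=
  @isMeasurable.Build (sigma_display (@open 'M[R]_(m, n))) 'M[R]_(m, n)
    <<s @open 'M[R]_(m, n) >> (@sigma_algebra0 _ setT _) (@sigma_algebraC _ _)
    (@sigma_algebra_bigcup _ setT _).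

Section euclidean.
Variable R : realType.

Definition dot m (x y : 'cV[R]_m) : R := \sum_i x i ord0 * y i ord0.

(* The library's `|x| on matrices is the sup norm, hence this definition. *)
Definition enorm m (x : 'cV[R]_m) : R := Num.sqrt (dot x x).

Definition opnorm m n (A : 'M[R]_(m, n)) : R :=
  sup [set enorm (A *m x) | x in [set x : 'cV[R]_n | enorm x <= 1]].

End euclidean.

Section complex_valued.
Variable R : realType.

Definition cexp (z : R[i]) : R[i] :=
  (expR (complex.Re z))%:C * (cos (complex.Im z) +i* sin (complex.Im z)).

(* Meaningful when the real and imaginary parts of f are integrable on D, which
   holds for the two integrands it is applied to below. *)
Definition cintegral d (T : measurableType d) (mu : {measure set T -> \bar R})
    (D : set T) (f : T -> R[i]) : R[i] :=
  (\int[mu]_(x in D) complex.Re (f x)) +i* (\int[mu]_(x in D) complex.Im (f x)).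

End complex_valued.

Section infinite_divisibility.
Variables (R : realType) (m : nat).
Local Notation V := 'cV[R]_m.

(* The recursion uses (mu * rho)(A) = \int rho(A - x) mu(dx). *)
Fixpoint convpow (mu : {measure set V -> \bar R}) (n : nat) : set V -> \bar R :=
  match n with
  | 0%N => fun A => \d_(0 : V) A
  | n'.+1 => fun A => (\int[mu]_x convpow mu n' [set y | A (x + y)%R])%E
  end.

Variables (d : measure_display) (Omega : measurableType d).
Variables (P : probability Omega R) (X : {mfun Omega >-> V}).

Definition infinitely_divisible : Prop :=
  forall n : nat, (0 < n)%N -> exists mu : probability V R,
    forall A : set V, measurable A -> distribution P X A = convpow mu n A.

Definition charfun (u : V) : R[i] :=
  cintegral P setT (fun w => cexp ('i%C * (dot u (X w))%:C)).

Definition levy_measure (nu : {measure set V -> \bar R}) : Prop :=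
  nu [set 0] = 0%E /\
  (\int[nu]_x (Num.min (enorm x ^+ 2) 1)%:E < +oo)%E.

Definition charexp (gamma : V) (Sigma : 'M[R]_m)
    (nu : {measure set V -> \bar R}) (u : V) : R[i] :=
  'i%C * (dot gamma u)%:C - (2^-1 * dot u (Sigma *m u))%:C
  + cintegral nu setT (fun x =>
      cexp ('i%C * (dot u x)%:C) - 1
      - 'i%C * (dot u x * \1_[set y : V | enorm y <= 1] x)%:C).

Definition has_characteristic_triplet (gamma : V) (Sigma : 'M[R]_m)
    (nu : {measure set V -> \bar R}) : Prop :=
  [/\ Sigma^T = Sigma,
      forall u : V, 0 <= dot u (Sigma *m u),
      levy_measure nu &
      forall u : V, charfun u = cexp (charexp gamma Sigma nu u)].

End infinite_divisibility.

(* Main.v *)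
Require Import Defs.
From HB Require Import structures.
From mathcomp Require Import all_boot all_order all_algebra.
From mathcomp Require Import all_classical all_reals all_analysis.
From mathcomp Require Import measurable_realfun complex ring lra.

(* Fix t > 0, Y = X_i a coordinate of X, and let D_t f(s) = 2 f(s) - f(s + t) -
   f(s - t).  For h = k/2, applying D_t^h to s |-> E cos(sY) and evaluating at 0
   gives E (2 - 2 cos(tY))^h, which controls t^k E Y^k; and D_t^h annihilates
   polynomials of degree less than k.  It therefore suffices to write
   E cos(sY) = exp(Re psi(s)) cos(Im psi(s)) as a polynomial of degree less than
   k plus a remainder of order s^k.  The moments of order 2 to k of nu provide
   such an expansion of psi, with constants depending on C0, C1 and k only once
   s is rescaled by any L > 0 dominating |gamma|, |Sigma|^(1/2), |c0| and |c1|;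
   expansions of this kind are stable under products and under composition with
   exp and cos.  The theorem results from the choice of L with L^k equal to the
   bracket of the statement plus an arbitrarily small positive number. *)

Set Implicit Arguments.
Unset Strict Implicit.
Unset Printing Implicit Defensive.

Import Order.TTheory GRing.Theory Num.Theory numFieldNormedType.Exports.

Local Open Scope classical_set_scope.
Local Open Scope ring_scope.

(** * Taylor polynomials *)

Section taylor.
Context {R : realType}.
Implicit Types (W f g : R -> R) (n k : nat) (p q : {poly R}).

(** The weight [W] is 1 for [cos] and [sin] and is [expR] for [expR], whose Taylor remainder exceeds
    every multiple of |y|^n for large y. *)
Definition taylor_bound W n f p :=
  [/\ (size p <= n)%N, forall i, `|p`_i| <= 1 &
      forall y, `|f y - p.[y]| <= W `|y| * `|y| ^+ n].

Lemma is_derive_within_continuous f g (D : set R) :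
  (forall y : R, is_derive y 1 f (g y)) -> {within D, continuous f}.
Proof.
move=> fg; apply: continuous_subspaceT => y.
by apply/differentiable_continuous/derivable1_diffP; case: (fg y).
Qed.

Lemma mean_value f g y : (forall z : R, is_derive z 1 f (g z)) ->
  exists2 c, `|c| <= `|y| & f y - f 0 = g c * y.
Proof.
move=> fg; have fc D := @is_derive_within_continuous f g D fg.
case: (leP 0 y) => y0.
  have [c] := MVT_segment y0 (fun z _ => fg z) (fc _).
  rewrite in_itv/= subr0 => /andP[c0 cy] ->.
  by exists c => //; rewrite !ger0_norm.
have [c] := MVT_segment (ltW y0) (fun z _ => fg z) (fc _).
rewrite in_itv/= sub0r => /andP[yc c0] e.
exists c; first by rewrite !ler0_norm ?lerN2// ltW.
by rewrite -[LHS]opprB e mulrN opprK.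
Qed.

Definition primitive (a : R) p : {poly R} :=
  \poly_(i < (size p).+1) (if i is j.+1 then p`_j / j.+1%:R else a).

Lemma coef_primitive a p i :
  (primitive a p)`_i = if i is j.+1 then p`_j / j.+1%:R else a.
Proof.
rewrite coef_poly; case: i => [//|j]; rewrite ltnS.
by case: ltnP => // pj; rewrite nth_default ?mul0r.
Qed.

Lemma deriv_primitive a p : (primitive a p)^`() = p.
Proof.
apply/polyP => i; rewrite coef_deriv coef_primitive/=.
by rewrite -[LHS]mulr_natr divfK// pnatr_eq0.
Qed.

(** The mean value theorem for f - P, whose derivative is g - p, gains one factor y. The
    intermediate point c satisfies |c| <= |y|, so monotonicity of [W] moves the bound from c to
    y. *)
Lemma taylor_bound_primitive W n f g p :
  (forall x, 0 <= W x) -> {homo W : x y / x <= y} ->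
  (forall y : R, is_derive y 1 f (g y)) ->
  `|f 0| <= 1 -> taylor_bound W n g p ->
  taylor_bound W n.+1 f (primitive (f 0) p).
Proof.
move=> W0 Wnd fg f0 [sp p1 gp]; split.
- by rewrite (leq_trans (size_poly _ _)).
- case=> [|i]; rewrite coef_primitive// normrM normfV normr_nat.
  rewrite ler_pdivrMr ?ltr0n// mul1r (le_trans (p1 _))//.
  by rewrite ler1n.
- move=> y; pose P := primitive (f 0) p.
  have d (z : R) : is_derive z 1 (f - horner P) (g z - p.[z]).
    have := is_deriveB (fg z) (is_derive_poly P z).
    by rewrite deriv_primitive.
  have [c cy] := mean_value y d.
  rewrite /= !fctE horner_coef0 coef_primitive subrr subr0 => ->.
  rewrite normrM exprSr mulrA ler_wpM2r//.
  apply: (le_trans (gp _)); apply: ler_pM; rewrite ?exprn_ge0//; first exact: Wnd.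
  by rewrite lerXn2r ?nnegrE.
Qed.

Lemma taylor_bound_at0 W n f p : taylor_bound W n.+1 f p -> p`_0 = f 0.
Proof.
case=> _ _ /(_ 0); rewrite normr0 expr0n mulr0 normr_le0 subr_eq0 horner_coef0.
by move/eqP.
Qed.

(** A joint induction, since up to sign each function is a primitive of the other. *)
Lemma taylor_cos_sin n :
  (exists p, taylor_bound (fun=> 1) n (@cos R) p) /\
  (exists p, taylor_bound (fun=> 1) n (@sin R) p).
Proof.
elim: n => [|n [[p cp] [q sq]]].
  split; exists 0; split=> [|i|y]; rewrite ?size_poly0 ?coef0 ?normr0// horner0 subr0.
    by rewrite mulr1 cos_max.
  by rewrite mulr1 sin_max.
split; last first.
  exists (primitive (sin 0) p).
  by apply: (@taylor_bound_primitive _ _ _ cos) => //; rewrite sin0 normr0.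
exists (primitive (cos 0) (- q)).
apply: (@taylor_bound_primitive _ _ _ (fun y => - sin y)) => //.
  by rewrite cos0 normr1.
case: sq => sq q1 sb; split=> [|i|y]; first by rewrite size_polyN.
  by rewrite coefN normrN.
by rewrite hornerN -opprD normrN.
Qed.

Lemma taylor_expR n : exists p, taylor_bound expR n (@expR R) p.
Proof.
elim: n => [|n [p ep]].
  exists 0; split=> [|i|y]; rewrite ?size_poly0 ?coef0 ?normr0// horner0 subr0.
  by rewrite mulr1 ger0_norm ?expR_ge0// ler_expR ler_norm.
exists (primitive (expR 0) p).
apply: (@taylor_bound_primitive _ _ _ expR) => //.
- by move=> x y; rewrite ler_expR.
- by rewrite expR0 normr1.
Qed.

(* The constant and linear terms of the integrands of the Levy-Khintchine
   exponent cancel, so that only moments of order at least 2 show up. *)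
Lemma taylor_cos_sub1 n : exists p, [/\ p`_0 = 0, p`_1 = 0 &
  taylor_bound (fun=> 1) n.+2 (fun y : R => cos y - 1) p].
Proof.
have [q sq] := (taylor_cos_sin n.+1).2; have q0 := taylor_bound_at0 sq.
exists (primitive 0 (- q)); rewrite !coef_primitive/= coefN q0 sin0 oppr0 mul0r.
split=> //.
have -> : 0 = (fun y : R => cos y - 1) 0 by rewrite /= cos0 subrr.
apply: (@taylor_bound_primitive _ _ _ (fun y => - sin y)) => //=.
- by move=> y; rewrite -[- sin y]subr0; apply: is_deriveB.
- by rewrite cos0 subrr normr0.
- case: sq => sq q1 sb; split=> [|i|y]; first by rewrite size_polyN.
    by rewrite coefN normrN.
  by rewrite hornerN -opprD normrN.
Qed.

Lemma taylor_sin_subid n : exists p, [/\ p`_0 = 0, p`_1 = 0 &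
  taylor_bound (fun=> 1) n.+2 (fun y : R => sin y - y) p].
Proof.
have [p cp] := (taylor_cos_sin n.+1).1.
(* The constant term of [p] is cos 0 = 1, so [p - 1] has none and its primitive has no linear
   term. *)
have p0 := taylor_bound_at0 cp; rewrite cos0 in p0.
exists (primitive 0 (p - 1)).
rewrite !coef_primitive/= coefB coef1 p0 subrr mul0r; split=> //.
have -> : 0 = (fun y : R => sin y - y) 0 by rewrite /= sin0 subrr.
apply: (@taylor_bound_primitive _ _ _ (fun y => cos y - 1)) => //=.
  by rewrite sin0 subrr normr0.
case: cp => sp p1 cb; split=> [|[|i]|y].
- by rewrite (leq_trans (size_polyD _ _))// geq_max sp size_polyN size_poly1.
- by rewrite coefB coef1 p0 subrr normr0.
- by rewrite coefB coef1 subr0.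
- by rewrite hornerD hornerN hornerC opprB addrA subrK.
Qed.

End taylor.

(** * Uniform polynomial approximation to order k at the origin *)

Section approximation.
Context {R : realType}.
Implicit Types (W f g u : R -> R) (n k : nat) (p q : {poly R}) (B : R).

(* A single constant controls the coefficients and the remainder, so that the
   closure properties below are uniform in the approximated function. *)
Definition poly_approx k B f p :=
  [/\ (size p <= k)%N, forall i, `|p`_i| <= B &
      forall t, `|t| <= 1 -> `|f t - p.[t]| <= B * `|t| ^+ k].

Definition approximable k B f := exists p, poly_approx k B f p.

Lemma coef_bound_ge0 B p : (forall i, `|p`_i| <= B) -> 0 <= B.
Proof. by move=> /(_ 0%N); exact: le_trans. Qed.

Lemma horner_bound n B p t : (size p <= n)%N -> (forall i, `|p`_i| <= B) ->
  `|t| <= 1 -> `|p.[t]| <= n%:R * B.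
Proof.
move=> sp pB t1; rewrite (horner_coef_wide _ sp).
apply: (le_trans (ler_norm_sum _ _ _)).
rewrite mulr_natl -[X in _ *+ X]card_ord -sumr_const; apply: ler_sum => i _.
rewrite normrM normrX -[leRHS]mulr1 ler_pM//.
by rewrite exprn_ile1.
Qed.

Lemma horner_bound_linear n B p t : (size p <= n)%N ->
  (forall i, `|p`_i| <= B) -> p`_0 = 0 ->
  `|t| <= 1 -> `|p.[t]| <= n%:R * B * `|t|.
Proof.
move=> sp pB p0 t1; have B0 := coef_bound_ge0 pB.
rewrite -(poly_take_drop 1 p) hornerD hornerM hornerXn expr1.
rewrite [take_poly 1 p](_ : _ = 0) ?horner0 ?add0r; last first.
  by apply/polyP => i; rewrite coef_take_poly coef0; case: i => [|i]//=; rewrite p0.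
rewrite normrM ler_wpM2r//; apply: horner_bound => // [|i].
  by rewrite size_drop_poly (leq_trans (leq_subr _ _)).
by rewrite coef_drop_poly.
Qed.

Lemma poly_approxD k B B' f g p q : poly_approx k B f p ->
  poly_approx k B' g q -> poly_approx k (B + B') (fun t => f t + g t) (p + q).
Proof.
move=> [sp pB fp] [sq qB gq]; split=> [|i|t t1].
- by rewrite (leq_trans (size_polyD _ _))// geq_max sp sq.
- by rewrite coefD (le_trans (ler_normD _ _))// lerD.
- rewrite hornerD opprD addrACA (le_trans (ler_normD _ _))// mulrDl.
  by rewrite lerD ?fp ?gq.
Qed.

Lemma poly_approx_monomial k B (a : R) n : `|a| <= B ->
  exists2 p : {poly R}, (n != 0%N -> p`_0 = 0) &
  poly_approx k B (fun t => a * t ^+ n) p.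
Proof.
move=> aB; have B0 : 0 <= B by exact: le_trans aB.
case: (ltnP n k) => [nk|kn].
  exists (a *: 'X^n); first by rewrite coefZ coefXn eq_sym => /negPf ->; rewrite mulr0.
  split=> [|i|t t1].
  - by rewrite (leq_trans (size_scale_leq _ _))// size_polyXn.
  - by rewrite coefZ coefXn; case: eqP; rewrite ?mulr1// mulr0 normr0.
  - by rewrite hornerZ hornerXn subrr normr0 mulr_ge0// exprn_ge0.
(* For n >= k the whole monomial counts as remainder, because |t|^n <= |t|^k when |t| <= 1. *)
exists 0; first by rewrite coef0.
split=> [|i|t t1]; rewrite ?size_poly0 ?coef0 ?normr0//.
rewrite horner0 subr0 normrM normrX ler_pM ?exprn_ge0//.
by rewrite ler_wiXn2l.
Qed.

Lemma approximable_perturb k B B' f g : approximable k B f ->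
  (forall t, `|t| <= 1 -> `|g t - f t| <= B' * `|t| ^+ k) ->
  approximable k (B + `|B'|) g.
Proof.
move=> [p [sp pB fp]] gf; exists p; split=> // [i|t t1].
  by rewrite ler_wpDr.
rewrite -[g t](subrK (f t)) -addrA mulrDl addrC (le_trans (ler_normD _ _))//.
rewrite lerD ?fp// (le_trans (gf _ t1))// ler_wpM2r ?exprn_ge0//.
exact: ler_norm.
Qed.

(** The approximating polynomial is the product [p * q] truncated below degree k; what is cut off is
    t^k times a polynomial with bounded coefficients. *)
Lemma approximableM k B B' : exists B3, forall f g,
  approximable k B f -> approximable k B' g ->
  approximable k B3 (fun t => f t * g t).
Proof.
pose K : R := k%:R.
(* [B0] bounds every coefficient of [p * q]. In the next line, the three summands inside the
   absolute value bound the truncated tail, f (g - q) and (f - p) q. Absolute values appear because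
   the constant is chosen before any approximant forces [B] and [B'] to be nonnegative. *)
pose B0 := (k + k).+1%:R * (`|B| * `|B'|).
exists (B0 + `|(k + k)%:R * B0 + (K * `|B| + `|B|) * `|B'| + `|B| * (K * `|B'|)|).
move=> f g [p [sp pB fp]] [q [sq qB gq]].
have hB := coef_bound_ge0 pB; have hB' := coef_bound_ge0 qB.
have B00 : 0 <= B0 by rewrite /B0 mulr_ge0// mulr_ge0.
have pqB i : `|(p * q)`_i| <= B0.
  have [ikk|ikk] := ltnP i (k + k); last first.
    rewrite nth_default ?normr0//.
    rewrite (leq_trans (size_polyMleq _ _))// (leq_trans (leq_pred _))//.
    by rewrite (leq_trans _ ikk)// leq_add.
  rewrite coefM (le_trans (ler_norm_sum _ _ _))//.
  apply: (@le_trans _ _ (\sum_(j < i.+1) (`|B| * `|B'|))).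
    apply: ler_sum => j _; rewrite normrM ler_pM//.
      exact: le_trans (ler_norm _).
    exact: le_trans (ler_norm _).
  rewrite sumr_const card_ord -mulr_natl ler_wpM2r ?mulr_ge0// ler_nat.
  by rewrite ltnS ltnW.
have spq : (size (p * q)%R <= k + k)%N.
  by rewrite (leq_trans (size_polyMleq _ _))// (leq_trans (leq_pred _))// leq_add.
have appr : approximable k B0 (fun t => (take_poly k (p * q)).[t]).
  exists (take_poly k (p * q)); split=> [|i|t t1].
  - exact: size_take_poly.
  - by rewrite coef_take_poly; case: ifP => // _; rewrite normr0.
  - by rewrite subrr normr0 mulr_ge0// exprn_ge0.
apply: (approximable_perturb appr) => t t1.
have qt := horner_bound sq qB t1; have pt := horner_bound sp pB t1.
have tk1 : `|t| ^+ k <= 1 by rewrite exprn_ile1.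
have tk0 : 0 <= `|t| ^+ k by rewrite exprn_ge0.
have ft : `|f t| <= K * `|B| + `|B|.
  rewrite -[f t](subrK p.[t]) addrC (le_trans (ler_normD _ _))// lerD//.
    by rewrite (ger0_norm hB).
  by rewrite (ger0_norm hB) (le_trans (fp _ t1))// ler_piMr.
have -> : f t * g t - (take_poly k (p * q)).[t] =
   (drop_poly k (p * q)).[t] * t ^+ k + f t * (g t - q.[t]) + (f t - p.[t]) * q.[t].
  have : (p * q).[t] = (take_poly k (p * q)).[t] + (drop_poly k (p * q)).[t] * t ^+ k.
    by rewrite -{1}(poly_take_drop k (p * q)) hornerD hornerM hornerXn.
  rewrite hornerM => e.
  have -> : (take_poly k (p * q)).[t] =
      p.[t] * q.[t] - (drop_poly k (p * q)).[t] * t ^+ k.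
    by rewrite e addrK.
  by ring.
rewrite !(mulrDl _ _ (`|t| ^+ k)).
apply: (le_trans (ler_normD _ _)); apply: lerD.
  apply: (le_trans (ler_normD _ _)); apply: lerD.
    rewrite normrM normrX ler_wpM2r//; apply: horner_bound => // [|i].
      by rewrite size_drop_poly (leq_trans (leq_subr _ _)).
    by rewrite coef_drop_poly.
  rewrite normrM -mulrA ler_pM// (ger0_norm hB'); exact: gq.
rewrite normrM mulrAC ler_pM ?mulr_ge0//; rewrite ?(ger0_norm hB) ?(ger0_norm hB')//.
exact: fp.
Qed.

(** Horner's scheme: one product and one added constant per coefficient of [p]. *)
Lemma approximable_horner k p B : exists B', forall u,
  approximable k B u -> approximable k B' (fun t => p.[u t]).
Proof.
elim/poly_ind: p => [|p c [B1 IH]].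
  exists 0 => u _; exists 0.
  split=> [|i|t t1]; rewrite ?size_poly0 ?coef0 ?horner0 ?normr0//.
  by rewrite subrr normr0 mul0r.
have [B2 H2] := approximableM k B1 B.
exists (B2 + `|c|) => u uB.
have [q uq] := H2 _ _ (IH _ uB) uB.
have [r _ cr] := poly_approx_monomial k 0 (lexx `|c|).
exists (q + r); have := poly_approxD uq cr.
by under eq_fun do rewrite expr0 mulr1 -hornerMXaddC.
Qed.

(** Without constant term in [q], u(t) = O(t), so the Taylor remainder of [g] at u(t) is O(t^k),
    while the Taylor polynomial of [g] at u(t) falls under [approximable_horner]. *)
Lemma approximable_comp W k g p B : (0 < k)%N ->
  (forall x, 0 <= W x) -> {homo W : x y / x <= y} -> taylor_bound W k g p ->
  exists B', forall u q, poly_approx k B u q -> q`_0 = 0 ->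
  approximable k B' (g \o u).
Proof.
move=> k0 W0 Wnd [_ _ gp]; have [B1 H] := approximable_horner k p B.
(* |u(t)| <= M |t|: the part k B comes from the polynomial [q], the extra B from the remainder, as
   |t|^k <= |t| for k > 0. *)
pose M := k.+1%:R * B.
exists (B1 + `|W M * M ^+ k|) => u q uq q0.
have uB : approximable k B u by exists q.
apply: (approximable_perturb (H _ uB)) => t t1.
case: uq => sq qB uq.
have uM : `|u t| <= M * `|t|.
  rewrite /M -natr1 mulrDl mul1r mulrDl -[u t](subrK q.[t]) addrC.
  rewrite (le_trans (ler_normD _ _))// lerD ?horner_bound_linear//.
  rewrite (le_trans (uq _ t1))// ler_wpM2l ?(coef_bound_ge0 qB)//.
  by rewrite -[leRHS]expr1 ler_wiXn2l.
have M0 : 0 <= M by rewrite mulr_ge0// (coef_bound_ge0 qB).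
rewrite (le_trans (gp _))// -mulrA -exprMn ler_pM ?exprn_ge0//.
  by rewrite Wnd// (le_trans uM)// ler_piMr.
by rewrite lerXn2r ?nnegrE// (le_trans _ uM).
Qed.

End approximation.

(** * Central second differences *)

Section second_difference.
Context {R : realType}.
Implicit Types (f g : R -> R) (p q : {poly R}) (t s M : R).

Definition diff2 t f s := 2 * f s - f (s + t) - f (s - t).

(** A translation of the variable preserves the degree and the leading coefficient, so the leading
    terms cancel. *)
Lemma size_comp_shift p t :
  (size ((p \Po ('X + t%:P)) - p)%R <= (size p).-1)%N.
Proof.
have sX : size ('X + t%:P : {poly R}) = 2 by rewrite size_XaddC.
apply/leq_sizeP => j; rewrite leq_eqVlt => /orP[/eqP <-|].
  rewrite coefB -lead_coefE -{1}(size_comp_poly2 p sX) -lead_coefE.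
  by rewrite lead_coef_comp ?sX// lead_coefXaddC expr1n mulr1 subrr.
move=> pj; have {}pj : (size p <= j)%N by case: (size p) pj.
by rewrite coefB !nth_default ?subrr// size_comp_poly2.
Qed.

Lemma diff2_horner t p : exists2 q : {poly R}, (size q <= size p - 2)%N &
  diff2 t (horner p) = horner q.
Proof.
pose S a (r : {poly R}) := (r \Po ('X + a%:P)) - r.
(* The central second difference is minus a forward difference of a backward difference; each of the
   two lowers the degree by one. *)
exists (- (S t (S t p \Po ('X + (- t)%:P)))).
  rewrite size_polyN (leq_trans (size_comp_shift _ _))//.
  rewrite size_comp_poly2 ?size_XaddC// subn2 -!subn1.
  by rewrite leq_sub2r// subn1 size_comp_shift.
apply/funext => s.
rewrite /S /diff2 !(hornerE, horner_comp) /=.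
have -> : s + t - t = s by ring.
have -> : s - t + t = s by ring.
by ring.
Qed.

Lemma iter_diff2_horner h t p : (size p <= h.*2)%N ->
  iter h (diff2 t) (horner p) = fun=> 0.
Proof.
elim: h p => [|h IH] p.
  rewrite leqn0 size_poly_eq0 => /eqP ->.
  by apply/funext => s; rewrite /= horner0.
move=> sp; have [q sq e] := diff2_horner t p.
rewrite iterSr e IH// (leq_trans sq)// leq_subLR.
by rewrite (leq_trans sp)// doubleS addnC addn2.
Qed.

Lemma iter_diff2B h t f g s :
  iter h (diff2 t) (fun y => f y - g y) s =
  iter h (diff2 t) f s - iter h (diff2 t) g s.
Proof.
elim: h s => [//|h IH] s; rewrite !iterS /diff2 !IH; by ring.
Qed.

(** Each application has coefficients of absolute sum 2 + 1 + 1 = 4 and moves the evaluation point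
    by at most |t|. *)
Lemma iter_diff2_bound h t f s M :
  (forall y, `|y - s| <= h%:R * `|t| -> `|f y| <= M) ->
  `|iter h (diff2 t) f s| <= 4 ^+ h * M.
Proof.
elim: h s => [|h IH] s fM.
  by rewrite /= expr0 mul1r fM// subrr normr0 mul0r.
rewrite iterS /diff2.
have IHs s' : `|s' - s| <= `|t| -> `|iter h (diff2 t) f s'| <= 4 ^+ h * M.
  move=> ss; apply: IH => y ys; apply: fM.
  rewrite -[y](subrK s') -addrA (le_trans (ler_normD _ _))//.
  by rewrite -natr1 mulrDl mul1r lerD.
have h0 := IHs s; rewrite subrr normr0 in h0.
have h1 := IHs (s + t); rewrite addrC addKr in h1.
have h2 := IHs (s - t); rewrite addrC addKr normrN in h2.
have {}h0 := h0 (normr_ge0 _); have {}h1 := h1 (lexx _); have {}h2 := h2 (lexx _).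
rewrite exprS.
apply: (le_trans (ler_normB _ _)).
apply: (@le_trans _ _ (2 * (4 ^+ h * M) + 4 ^+ h * M + 4 ^+ h * M)); last lra.
apply: lerD; last exact: h2.
apply: (le_trans (ler_normB _ _)); apply: lerD; last exact: h1.
by rewrite normrM ger0_norm// ler_wpM2l.
Qed.

(** Subtracting the approximating polynomial does not change the iterated difference, so only the
    remainder contributes. *)
Lemma approximable_iter_diff2 h B f t : approximable h.*2 B f ->
  h%:R * `|t| <= 1 ->
  `|iter h (diff2 t) f 0| <= 4 ^+ h * (B * (h%:R * `|t|) ^+ h.*2).
Proof.
move=> [p [sp pB fp]] ht1.
have -> : iter h (diff2 t) f 0 = iter h (diff2 t) (fun y => f y - p.[y]) 0.
  by rewrite iter_diff2B iter_diff2_horner// subr0.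
apply: iter_diff2_bound => y; rewrite subr0 => yt.
rewrite (le_trans (fp _ (le_trans yt ht1)))//.
by rewrite ler_wpM2l ?(coef_bound_ge0 pB)// lerXn2r ?nnegrE ?mulr_ge0.
Qed.

End second_difference.

(** * Moments from the characteristic function *)

Section moments.
Context {R : realType}.

Lemma sin_le_norm (x : R) : `|sin x| <= `|x|.
Proof.
have [c _] := @mean_value R sin cos x (fun z => is_derive_sin z).
by rewrite sin0 subr0 => ->; rewrite normrM ler_piMl// cos_max.
Qed.

Lemma two_sub_2cos (x : R) : 2 - 2 * cos x = 4 * sin (x / 2) ^+ 2.
Proof.
have -> : cos x = cos (x / 2 + x / 2) by congr cos; field.
by rewrite cosD -!expr2 cos2sin2; ring.
Qed.

Lemma two_sub_2cos_lower (x : R) : `|x| <= 2 -> (x / 2) ^+ 2 <= 2 - 2 * cos x.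
Proof.
move=> x2; rewrite two_sub_2cos.
have [c cx] := @mean_value R sin cos (x / 2) (fun z => is_derive_sin z).
rewrite sin0 subr0 => ->.
have x1 : `|x / 2| <= 1.
  by rewrite normrM normfV (ger0_norm (ler0n _ _)) ler_pdivrMr// mul1r.
(* Here cos c = 1 - 2 sin(c/2)^2 with |c| <= 1, hence |sin(c/2)| <= 1/2. Then 4 cos(c)^2 >= 1, which
   is the factor needed below. *)
have cc : 2^-1 <= cos c.
  have := two_sub_2cos c; have := sin_le_norm (c / 2).
  rewrite normrM normfV (ger0_norm (ler0n _ _)) => sc e.
  have {}sc : `|sin (c / 2)| <= 2^-1.
    by apply: (le_trans sc); rewrite ler_piMl// (le_trans cx).
  have : sin (c / 2) ^+ 2 <= (2^-1) ^+ 2.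
    by rewrite -real_normK ?num_real// lerXn2r ?nnegrE ?invr_ge0.
  by lra.
rewrite (exprMn 2 (cos c)) mulrA ler_peMl ?sqr_ge0//.
have : 2^-1 ^+ 2 <= cos c ^+ 2 by rewrite lerXn2r ?nnegrE//; lra.
by lra.
Qed.

Context d (T : measurableType d) (P : probability T R) (Y : T -> R).
Hypothesis mY : measurable_fun setT Y.

Lemma measurable_cosM s : measurable_fun setT (fun w => cos (s * Y w)).
Proof.
apply: measurableT_comp => //.
  by apply: continuous_measurable_fun; exact: continuous_cos.
by apply: measurable_funM.
Qed.

Lemma measurable_diff2_cos h t s :
  measurable_fun setT (fun w => (2 - 2 * cos (t * Y w)) ^+ h * cos (s * Y w)).
Proof.
apply: measurable_funM; last exact: measurable_cosM.
apply: measurable_funX; apply: measurable_funB => //.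
by apply: measurable_funM => //; exact: measurable_cosM.
Qed.

Lemma integrable_diff2_cos h t s : P.-integrable setT
  (EFin \o (fun w => (2 - 2 * cos (t * Y w)) ^+ h * cos (s * Y w))).
Proof.
apply: measurable_bounded_integrable => //.
- by rewrite (le_lt_trans (probability_le1 _ _))// ltry.
- exact: measurable_diff2_cos.
exists (4 ^+ h); split; first exact: num_real.
move=> M hM w _; apply: le_trans (ltW hM).
have c1 : cos (t * Y w) <= 1 := cos_le1 _; have c2 : -1 <= cos (t * Y w) := cos_geN1 _.
rewrite normrM normrX -[leRHS]mulr1 ler_pM// ?exprn_ge0// ?cos_max//.
by rewrite lerXn2r ?nnegrE// ger0_norm; lra.
Qed.

(** By the addition formulas, applying [diff2 t] to s |-> cos(sY) multiplies it by 2 - 2 cos(tY). *)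
Lemma iter_diff2_cos h t s :
  iter h (diff2 t) (fun s => \int[P]_w cos (s * Y w)) s =
  \int[P]_w ((2 - 2 * cos (t * Y w)) ^+ h * cos (s * Y w)).
Proof.
elim: h s => [|h IH] s.
  by rewrite /=; apply: eq_Rintegral => w _; rewrite expr0 mul1r.
rewrite iterS {1}/diff2 !IH.
have i s' := integrable_diff2_cos h t s'.
rewrite -RintegralZl// -RintegralB//; last first.
  by have := integrableZl measurableT 2 (i s).
rewrite -RintegralB//; last first.
  apply: (@integrableB _ _ _ P setT measurableT (EFin \o _) (EFin \o _)) => //.
  by have := integrableZl measurableT 2 (i s).
apply: eq_Rintegral => w _.
by rewrite (mulrDl s t) (mulrBl (Y w) s t) cosD cosB exprS; ring.
Qed.

(** Finiteness of the moment is part of the conclusion, so Y is first restricted to |Y| <= n. There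
    Y^2 <= (4 / t^2) (2 - 2 cos(tY)) for small t, the resulting bound does not depend on n, and
    monotone convergence removes the restriction. *)
Lemma even_moment_bound h B :
  approximable h.*2 B (fun s => \int[P]_w cos (s * Y w)) ->
  (\int[P]_w (Y w ^+ h.*2)%:E <= (16 ^+ h * (B * h%:R ^+ h.*2))%:E)%E.
Proof.
move=> appr; pose F n := [set w | `|Y w| <= n%:R].
have mF n : measurable (F n).
  rewrite (_ : F n = setT `&` Y @^-1` [set` `[- n%:R, n%:R]]); first exact: mY.
  by rewrite setTI; apply/seteqP; split=> w; rewrite /F /= in_itv/= ler_norml.
have mYh D : measurable_fun D (fun w => (Y w ^+ h.*2)%:E).
  by apply/measurable_EFinP; apply: measurable_funX; exact: measurable_funS mY.
have Yh0 w : 0 <= Y w ^+ h.*2 by rewrite -muln2 mulnC exprM exprn_ge0// sqr_ge0.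
have FT : \bigcup_i F i = setT.
  apply/seteqP; split => // w _; exists (Num.trunc `|Y w|).+1 => //.
  by rewrite /F; apply: ltW; rewrite -truncn_lt_nat.
have ndF : nondecreasing_seq F.
  move=> a b ab; rewrite subsetEset => w /= /le_trans; apply.
  by rewrite ler_nat.
have cvgF := ge0_nondecreasing_set_cvg_integral (f := fun w => (Y w ^+ h.*2)%:E)
  (mu := P) ndF mF (fun n => mYh (F n)) (fun n w _ => Yh0 w).
rewrite FT in cvgF; rewrite -(cvg_lim _ cvgF)//.
apply: lime_le; first by apply/cvg_ex; eexists; exact: cvgF.
apply: nearW => n.
(* Small enough for both h t <= 1, required by the difference estimate, and |t Y| <= 2 on [F n],
   required by [two_sub_2cos_lower]. *)
pose t : R := (n + h).+1%:R^-1.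
have t0 : 0 < t by rewrite invr_gt0 ltr0n.
have ht : h%:R * `|t| <= 1.
  rewrite (gtr0_norm t0) ler_pdivrMr ?ltr0n// mul1r ler_nat.
  by rewrite (leq_trans (leq_addl n h)).
have th : 0 <= (4 / t ^+ 2) ^+ h by rewrite exprn_ge0// divr_ge0// sqr_ge0.
have := approximable_iter_diff2 appr ht; rewrite iter_diff2_cos.
set I := Rintegral _ _ _ => IB.
have : (\int[P]_(w in F n) (Y w ^+ h.*2)%:E <= ((4 / t ^+ 2) ^+ h * I)%:E)%E.
  pose g w := (2 - 2 * cos (t * Y w)) ^+ h * cos (0 * Y w).
  have g0 w : 0 <= g w.
    by rewrite /g mul0r cos0 mulr1 exprn_ge0//.
  rewrite EFinM; have -> : I%:E = integral P setT (fun w => (g w)%:E).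
    by rewrite fineK//; exact: integrable_fin_num (integrable_diff2_cos h t 0).
  have mg : measurable_fun setT (fun w => (g w)%:E).
    by apply/measurable_EFinP; exact: measurable_diff2_cos.
  rewrite -ge0_integralZl_EFin//; last by move=> w _; rewrite lee_fin.
  apply: (@le_trans _ _ (\int[P]_(w in F n) (((4 / t ^+ 2) ^+ h)%:E * (g w)%:E))%E).
    apply: ge0_le_integral => //.
    - by move=> w _; rewrite lee_fin.
    - apply: (measurable_funS measurableT) => //.
      by apply: measurable_funeM.
    - move=> w Fw; rewrite -EFinM lee_fin /g mul0r cos0 mulr1 -exprMn -mul2n exprM.
      have tY : `|t * Y w| <= 2.
        rewrite normrM (gtr0_norm t0) mulrC ler_pdivrMr ?ltr0n//.
        rewrite (le_trans Fw)// -natrM ler_nat.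
        by rewrite mulnC (leq_trans (leq_addr h n))// (leq_trans (leqnSn _))// leq_pmulr.
      have -> : Y w ^+ 2 = 4 / t ^+ 2 * (t * Y w / 2) ^+ 2.
        by field; rewrite gt_eqF.
      have c1 := cos_le1 (t * Y w).
      have t4 : 0 <= 4 / t ^+ 2 by rewrite divr_ge0// sqr_ge0.
      rewrite lerXn2r ?nnegrE//; first exact: mulr_ge0 t4 (sqr_ge0 _).
        by rewrite mulr_ge0//; lra.
      rewrite ler_wpM2l//.
      exact: two_sub_2cos_lower.
  apply: ge0_subset_integral => //.
    by apply: measurable_funeM.
  by move=> w _; rewrite mule_ge0// lee_fin.
move=> /le_trans; apply; rewrite lee_fin.
apply: le_trans (ler_wpM2l th (le_trans (ler_norm _) IB)) _.
rewrite (gtr0_norm t0) le_eqVlt; apply/orP; left; apply/eqP.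
(* The powers of t cancel: (4 / t^2)^h 4^h B (h t)^(2h) = 16^h B h^(2h). *)
have -> : 16 = 4 * 4 :> R by ring.
rewrite -mul2n expr_div_n (exprM h%:R) (exprM (h%:R * t)).
rewrite (exprMn 2 h%:R) (exprMn h (h%:R ^+ 2)) (exprMn h 4).
have : (t ^+ 2) ^+ h != 0 by rewrite !expf_neq0// gt_eqF.
by move: ((t ^+ 2) ^+ h) (4 ^+ h) => u v u0; field.
Qed.

End moments.

(** * Taylor expansions integrated against a measure *)

Section integrated_expansion.
Context {R : realType} d (T : measurableType d) (mu : {measure set T -> \bar R}).

Lemma integrable_Rintegral_sum n (F : nat -> T -> R) :
  (forall i, (i < n)%N -> mu.-integrable setT (EFin \o F i)) ->
  mu.-integrable setT (EFin \o (fun x => \sum_(i < n) F i x)) /\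
  \int[mu]_x (\sum_(i < n) F i x) = \sum_(i < n) \int[mu]_x F i x.
Proof.
elim: n => [_|n IH iF].
  rewrite (_ : (fun x => _) = fun=> 0); last by apply/funext => x; rewrite big_ord0.
  rewrite big_ord0; split; first exact: integrable0.
  by rewrite /Rintegral integral0.
have [|i1 e1] := IH; first by move=> i /ltnW; exact: iF.
rewrite (_ : (fun x => _) = (fun x => \sum_(i < n) F i x + F n x)); last first.
  by apply/funext => x; rewrite big_ord_recr.
rewrite big_ord_recr/= -e1; split; last by rewrite RintegralD//; exact: iF.
by apply: (@integrableD _ _ _ mu setT measurableT (EFin \o _) (EFin \o _)) => //;
  exact: iF.
Qed.

Lemma le_norm_Rintegral (f g : T -> R) B : measurable_fun setT f ->
  measurable_fun setT g -> (forall x, `|f x| <= g x) ->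
  (\int[mu]_x (g x)%:E <= B%:E)%E ->
  mu.-integrable setT (EFin \o f) /\ `|\int[mu]_x f x| <= B.
Proof.
move=> mf mg fg gB.
have g0 x : 0 <= g x by exact: le_trans (fg x).
have ig : mu.-integrable setT (EFin \o g).
  apply/integrableP; split; first exact/measurable_EFinP.
  under eq_integral do rewrite gee0_abs ?lee_fin//.
  by rewrite (le_lt_trans gB)// ltry.
have if_ : mu.-integrable setT (EFin \o f).
  apply: (le_integrable _ _ _ ig) => //; first exact/measurable_EFinP.
  by move=> x _ /=; rewrite lee_fin (ger0_norm (g0 x)).
split=> //; rewrite (le_trans (le_normr_Rintegral _ if_))//.
rewrite -lee_fin fineK; last first.
  by apply: integrable_fin_num => //; have := integrable_norm if_.
apply: le_trans gB; apply: ge0_le_integral => //.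
- by apply/measurable_EFinP; exact: measurableT_comp.
- by exact/measurable_EFinP.
by move=> x _; rewrite lee_fin.
Qed.

(** The Taylor expansion of g(t a(x)) is integrated term by term. As [mu] may be infinite and only
    moments of order 2 to k are controlled, the terms of order 0 and 1 have to vanish; the remainder
    is at most |t|^k times the k-th absolute moment. *)
Lemma approx_Rintegral k B (a : T -> R) (g : R -> R) (p : {poly R}) :
  measurable_fun setT a -> measurable_fun setT g ->
  (forall r, (2 <= r <= k)%N -> (\int[mu]_x (`|a x| ^+ r)%:E <= B%:E)%E) ->
  (2 <= k)%N ->
  taylor_bound (fun=> 1) k g p -> p`_0 = 0 -> p`_1 = 0 ->
  (forall t, mu.-integrable setT (EFin \o (fun x => g (t * a x)))) /\
  exists2 q : {poly R}, q`_0 = 0 &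
    poly_approx k B (fun t => \int[mu]_x g (t * a x)) q.
Proof.
move=> ma mg aB k2 [sp p1 gp] p00 p01.
have B0 : 0 <= B.
  rewrite -lee_fin; apply: le_trans (aB 2%N _); last by rewrite k2.
  by apply: integral_ge0 => x _; rewrite lee_fin exprn_ge0.
pose M i := \int[mu]_x (a x ^+ i).
have maX i : measurable_fun setT (fun x => a x ^+ i) by exact: measurable_funX.
have mnaX i : measurable_fun setT (fun x => `|a x| ^+ i).
  by apply: measurable_funX; exact: measurableT_comp.
have MB i : (2 <= i <= k)%N ->
    mu.-integrable setT (EFin \o (fun x => a x ^+ i)) /\ `|M i| <= B.
  move=> ik; apply: le_norm_Rintegral (aB i ik) => // x.
  by rewrite normrX.
have pa t : mu.-integrable setT (EFin \o (fun x => p.[t * a x])) /\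
    \int[mu]_x p.[t * a x] = \sum_(i < k) p`_i * t ^+ i * M i.
  have Ei i : (i < k)%N ->
      mu.-integrable setT (EFin \o (fun x => p`_i * t ^+ i * a x ^+ i)) /\
      \int[mu]_x (p`_i * t ^+ i * a x ^+ i) = p`_i * t ^+ i * M i.
    move=> ik; case: (ltnP 1 i) => i1.
      have [|ia _] := MB i; first by rewrite i1 ltnW.
      split; last by rewrite RintegralZl.
      by have := integrableZl measurableT (p`_i * t ^+ i) ia.
    (* For i <= 1 the power of [a] may fail to be integrable, but its coefficient is zero. *)
    have -> : p`_i = 0 by case: i i1 {ik} => [|[|]].
    rewrite (_ : (fun x => _) = fun=> 0); last by apply/funext => x; rewrite !mul0r.
    by rewrite !mul0r; split; [exact: integrable0|rewrite /Rintegral integral0].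
  rewrite (_ : (fun x => _) = (fun x => \sum_(i < k) p`_i * t ^+ i * a x ^+ i)).
    have [i1 e1] := integrable_Rintegral_sum (fun i ik => (Ei i ik).1).
    by split=> //; rewrite e1; apply: eq_bigr => i _; rewrite (Ei _ _).2.
  apply/funext => x; rewrite (horner_coef_wide _ sp).
  by apply: eq_bigr => i _; rewrite exprMn mulrA.
have rem t : mu.-integrable setT (EFin \o (fun x => g (t * a x) - p.[t * a x])) /\
    `|\int[mu]_x (g (t * a x) - p.[t * a x])| <= B * `|t| ^+ k.
  apply: (@le_norm_Rintegral _ (fun x => `|t| ^+ k * `|a x| ^+ k)).
  - have mta : measurable_fun setT (fun x => t * a x) by exact: measurable_funM.
    apply: measurable_funB; first exact: measurableT_comp mta.
    apply: measurableT_comp mta; apply: continuous_measurable_fun.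
    exact: continuous_horner.
  - by apply: measurable_funM.
  - by move=> x; rewrite (le_trans (gp _))// mul1r normrM exprMn.
  - under eq_integral do rewrite EFinM.
    rewrite ge0_integralZl_EFin//; last exact/measurable_EFinP.
    by rewrite muleC EFinM lee_wpmul2r ?lee_fin ?exprn_ge0// aB// k2 leqnn.
have ig t : mu.-integrable setT (EFin \o (fun x => g (t * a x))).
  rewrite (_ : (fun x => _) = (fun x => g (t * a x) - p.[t * a x] + p.[t * a x])).
    apply: (@integrableD _ _ _ mu setT measurableT (EFin \o _) (EFin \o _)) => //.
      exact: (rem t).1.
    exact: (pa t).1.
  by apply/funext => x; rewrite subrK.
split=> //; exists (\poly_(i < k) (p`_i * M i)).
  by rewrite coef_poly p00 mul0r; case: ifP.
split=> [|i|t t1].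
- exact: size_poly.
- rewrite coef_poly; case: ltnP => [ik|_]; last by rewrite normr0.
  case: i ik => [|[|i]] ik; rewrite ?p00 ?p01 ?mul0r ?normr0//.
  rewrite normrM -[leRHS]mul1r ler_pM//.
  by have [|_] := MB i.+2; first exact: ltnW.
- rewrite horner_poly.
  have -> : \sum_(i < k) p`_i * M i * t ^+ i = \int[mu]_x p.[t * a x].
    by rewrite (pa t).2; apply: eq_bigr => i _; rewrite mulrAC.
  rewrite -RintegralB//; first exact: (rem t).2.
  exact: (pa t).1.
Qed.

End integrated_expansion.

(** * Euclidean vectors and the characteristic exponent *)

Section euclidean_facts.
Context {R : realType} {m : nat}.
Implicit Types (x y : 'cV[R]_m).

Lemma dot_ge0 n (x : 'cV[R]_n) : 0 <= dot x x.
Proof. by apply: sumr_ge0 => i _; rewrite -expr2 sqr_ge0. Qed.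

Lemma enorm_ge0 x : 0 <= enorm x.
Proof. exact: sqrtr_ge0. Qed.

Lemma norm_coord_le_enorm n (x : 'cV[R]_n) i : `|x i ord0| <= enorm x.
Proof.
rewrite -sqrtr_sqr ler_wsqrtr// /dot (bigD1 i)//= -expr2 lerDl.
by apply: sumr_ge0 => j _; rewrite -expr2 sqr_ge0.
Qed.

(** The squared norm is at most m times the largest squared coordinate, whose h-th power is one of
    the summands on the right. *)
Lemma enorm_even_power_le h x : (0 < h)%N ->
  enorm x ^+ h.*2 <= m%:R ^+ h * \sum_(i < m) x i ord0 ^+ h.*2.
Proof.
move=> h0; rewrite -mul2n exprM sqr_sqrtr ?dot_ge0//.
have sq0 i : 0 <= x i ord0 ^+ 2 := sqr_ge0 _.
have S0 : 0 <= m%:R ^+ h * \sum_(i < m) x i ord0 ^+ (2 * h).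
  by rewrite mulr_ge0// sumr_ge0// => i _; rewrite exprM exprn_ge0.
(* For m = 0 there is no largest coordinate; the left side is then 0^h = 0 since h > 0. *)
case: (pickP 'I_m) => [i0 _|I0]; last first.
  by rewrite {1}/dot big_pred0 ?expr0n ?(gtn_eqF h0).
have [j _ jmax] := @Order.TotalTheory.arg_maxP _ _ 'I_m i0 predT
  (fun i => x i ord0 ^+ 2) isT.
apply: (@le_trans _ _ ((m%:R * x j ord0 ^+ 2) ^+ h)).
  rewrite lerXn2r ?nnegrE ?dot_ge0//; first exact: mulr_ge0 (ler0n _ _) (sq0 j).
  rewrite mulr_natl -[X in _ *+ X]card_ord -sumr_const.
  by apply: ler_sum => i _; rewrite -expr2; exact: jmax.
rewrite (exprMn h m%:R) ler_wpM2l// (bigD1 j)//= exprM lerDl.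
by apply: sumr_ge0 => i _; rewrite exprM exprn_ge0.
Qed.

Lemma le_opnorm n (A : 'M[R]_(m, n)) (x : 'cV[R]_n) :
  enorm x <= 1 -> enorm (A *m x) <= opnorm A.
Proof.
move=> x1; apply: ub_le_sup; last by exists x.
(* [sup] dominates the set only once an upper bound is known; this one works because the coordinates
   of a vector in the unit ball are at most 1 in absolute value. *)
exists (Num.sqrt (\sum_i (\sum_j `|A i j|) ^+ 2)) => _ [y /= y1 <-].
apply: ler_wsqrtr; apply: ler_sum => i _; rewrite -expr2 -real_normK ?num_real//.
rewrite lerXn2r ?nnegrE ?sumr_ge0// mxE (le_trans (ler_norm_sum _ _ _))//.
apply: ler_sum => j _; rewrite normrM ler_piMr//.
by rewrite (le_trans (norm_coord_le_enorm _ _)).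
Qed.

Definition basis_vector (i : 'I_m) : 'cV[R]_m := delta_mx i ord0.

Lemma dot_basis_vector (s : R) i x : dot (s *: basis_vector i) x = s * x i ord0.
Proof.
rewrite /dot (bigD1 i)//= big1 ?addr0; first by rewrite !mxE !eqxx mulr1.
by move=> j ji; rewrite !mxE (negPf ji) mulr0 mul0r.
Qed.

Lemma enorm_basis_vector i : enorm (basis_vector i) = 1.
Proof.
rewrite /enorm -{1}[basis_vector i]scale1r dot_basis_vector.
by rewrite mxE !eqxx mulr1 sqrtr1.
Qed.

Lemma mul_basis_vector n (A : 'M[R]_(n, m)) (s : R) i j :
  (A *m (s *: basis_vector i)) j ord0 = s * A j i.
Proof.
rewrite mxE (bigD1 i)//= big1 ?addr0; first by rewrite !mxE !eqxx mulr1 mulrC.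
by move=> l li; rewrite !mxE (negPf li) !mulr0.
Qed.

Lemma norm_entry_le_opnorm (A : 'M[R]_m) i : `|A i i| <= opnorm A.
Proof.
have := norm_coord_le_enorm (A *m (1 *: basis_vector i)) i.
rewrite mul_basis_vector mul1r => /le_trans; apply.
by apply: le_opnorm; rewrite scale1r enorm_basis_vector.
Qed.

Lemma continuous_matrix_measurable n (f : 'M[R]_(m, n) -> R) :
  continuous f -> measurable_fun setT f.
Proof.
move=> /continuousP cf; apply: (measurability _ (RGenOpens.measurableE R)).
move=> _ [_ [a [b ->] <-]]; rewrite setTI; apply: sub_sigma_algebra.
exact/cf/interval_open.
Qed.

Lemma measurable_coord i : measurable_fun setT (fun x : 'cV[R]_m => x i ord0).
Proof. by apply: continuous_matrix_measurable; exact: coord_continuous. Qed.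

Lemma measurable_enorm : measurable_fun setT (@enorm R m).
Proof.
apply: (@measurableT_comp _ _ _ _ _ _ (@Num.sqrt R)).
  by apply: continuous_measurable_fun; exact: sqrt_continuous.
apply: measurable_sum => i; apply: measurable_funM; exact: measurable_coord.
Qed.

End euclidean_facts.

Section complex_facts.
Context {R : realType}.
Local Open Scope complex_scope.

Lemma cexp_imaginary (r : R) : cexp ('i%C * r%:C) = cos r +i* sin r.
Proof.
by rewrite /cexp /= !mul0r !mul1r subr0 add0r expR0 rmorph1 mul1r.
Qed.

End complex_facts.

Section characteristic_exponent.
Context {R : realType} {m : nat}.
Local Notation V := 'cV[R]_m.
Local Open Scope complex_scope.

Lemma Re_cexp (z : R[i]) : complex.Re (cexp z) = expR (complex.Re z) * cos (complex.Im z).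
Proof. by rewrite /cexp /= mul0r subr0. Qed.

(** The real part of the Levy-Khintchine formula at s times the i-th basis vector, which reduces the
    problem to real integrals in one real variable. *)
Lemma charfun_coord d (Omega : measurableType d) (P : probability Omega R)
    (X : {mfun Omega >-> V}) gamma Sigma (nu : {measure set V -> \bar R}) i s :
  has_characteristic_triplet P X gamma Sigma nu ->
  \int[P]_w cos (s * X w i ord0) =
  expR (- (2^-1 * (s ^+ 2 * Sigma i i)) + \int[nu]_x (cos (s * x i ord0) - 1)) *
  cos (s * gamma i ord0 + \int[nu]_x (sin (s * x i ord0) -
         s * x i ord0 * \1_[set y : V | enorm y <= 1] x)).
Proof.
move=> [_ _ _ /(_ (s *: basis_vector i))/(congr1 (@complex.Re R))].
rewrite Re_cexp.
have -> : complex.Re (charfun P X (s *: basis_vector i)) = \int[P]_w cos (s * X w i ord0).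
  by apply: eq_Rintegral => w _; rewrite cexp_imaginary dot_basis_vector.
move=> ->; congr (expR _ * cos _).
  rewrite /charexp /=; congr (_ + _).
  - by rewrite dot_basis_vector mul_basis_vector; ring.
  - apply: eq_Rintegral => x _.
    by rewrite dot_basis_vector !(mul0r, mul1r, subr0, add0r) oppr0 expR0; ring.
rewrite /charexp /=; congr (_ + _).
- have -> : dot gamma (s *: basis_vector i) = dot (s *: basis_vector i) gamma.
    by apply: eq_bigr => j _; rewrite mulrC.
  by rewrite dot_basis_vector; ring.
- apply: eq_Rintegral => x _ /=.
  by rewrite dot_basis_vector !(mul0r, mul1r, subr0, add0r) oppr0 expR0; ring.
Qed.

End characteristic_exponent.

(** * Rescaled moments of the Levy measure *)

Section coordinate_bound.
Context {R : realType} {m : nat}.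
Local Notation V := 'cV[R]_m.

(** Division by L^r absorbs c^r, since |c / L| <= 1; the bound that remains depends on [C] alone. *)
Lemma scaled_moment (nu : {measure set V -> \bar R}) (D : set V) (L C c : R) r :
  measurable D -> 0 < L -> `|c| <= L ->
  (\int[nu]_(x in D) (enorm x ^+ r)%:E <= (C * c ^+ r)%:E)%E ->
  (\int[nu]_(x in D) ((enorm x / L) ^+ r)%:E <= `|C|%:E)%E.
Proof.
move=> mD L0 cL H.
have Lr : 0 < L ^- r by rewrite invr_gt0 exprn_gt0.
have mE : measurable_fun D (fun x : V => (enorm x ^+ r)%:E).
  apply/measurable_EFinP/measurable_funX/(measurable_funS measurableT) => //.
  exact: measurable_enorm.
under eq_integral do rewrite exprMn exprVn mulrC EFinM.
rewrite ge0_integralZl_EFin//;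
  [|by move=> x _; rewrite lee_fin exprn_ge0 ?enorm_ge0|exact: ltW].
apply: (le_trans (lee_wpmul2l _ H)); first by rewrite lee_fin ltW.
rewrite -EFinM lee_fin mulrCA -exprVn -exprMn.
rewrite (le_trans (ler_norm _))// normrM ler_piMr// normrX exprn_ile1//.
by rewrite normrM normfV (gtr0_norm L0) mulrC ler_pdivrMr// mul1r.
Qed.

Lemma measurable_jump_sizes : measurable [set x : V | enorm x < 1] /\
  measurable [set x : V | 1 <= enorm x].
Proof.
split.
  rewrite (_ : mkset _ = setT `&` @enorm R m @^-1` [set` `]-oo, 1[]).
    exact: measurable_enorm.
  by rewrite setTI; apply/seteqP; split=> x; rewrite /= in_itv.
rewrite (_ : mkset _ = setT `&` @enorm R m @^-1` [set` `[1, +oo[]).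
  exact: measurable_enorm.
by rewrite setTI; apply/seteqP; split=> x; rewrite /= in_itv/= andbT.
Qed.

Lemma coord_moment (nu : {measure set V -> \bar R}) (L C0 C1 c0 c1 : R) r i :
  0 < L -> `|c0| <= L -> `|c1| <= L ->
  (\int[nu]_(x in [set x : V | (enorm x < 1)%R]) (enorm x ^+ r)%:E
     <= (C0 * c0 ^+ r)%:E)%E ->
  (\int[nu]_(x in [set x : V | (1 <= enorm x)%R]) (enorm x ^+ r)%:E
     <= (C1 * c1 ^+ r)%:E)%E ->
  (\int[nu]_x (`|x i ord0 / L| ^+ r)%:E <= (`|C0| + `|C1|)%:E)%E.
Proof.
move=> L0 c0L c1L H0 H1; have [mb mB] := measurable_jump_sizes.
have me D : measurable_fun D (fun x : V => ((enorm x / L) ^+ r)%:E).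
  apply/measurable_EFinP/measurable_funX/(measurable_funS measurableT) => //.
  by apply: measurable_funM => //; exact: measurable_enorm.
have e0 (x : V) : 0 <= (enorm x / L) ^+ r.
  by rewrite exprn_ge0// divr_ge0 ?enorm_ge0// ltW.
apply: (@le_trans _ _ (\int[nu]_x ((enorm x / L) ^+ r)%:E)%E).
  apply: ge0_le_integral => //.
  - by apply/measurable_EFinP/measurable_funX/measurableT_comp => //;
      apply: measurable_funM => //; exact: measurable_coord.
  - move=> x _; rewrite lee_fin lerXn2r ?nnegrE ?divr_ge0 ?enorm_ge0 ?(ltW L0)//.
    by rewrite normrM normfV (gtr0_norm L0) ler_wpM2r ?invr_ge0 ?(ltW L0)//
      norm_coord_le_enorm.
rewrite (_ : setT = [set x : V | enorm x < 1] `|` [set x : V | 1 <= enorm x]); last first.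
  by apply/seteqP; split=> // x _ /=; case: (ltP (enorm x) 1); [left|right].
rewrite ge0_integral_setU//.
- by rewrite EFinD leeD//; [exact: scaled_moment H0|exact: scaled_moment H1].
- by move=> x _; rewrite lee_fin.
- by apply/disj_setPRL => x /= h1 h2; move: h1; rewrite leNgt h2.
Qed.

End coordinate_bound.

(** * Uniform expansion of the characteristic function along a coordinate axis *)

Section characteristic_function_expansion.
Context {R : realType} {m : nat}.
Local Notation V := 'cV[R]_m.

(** Replacing the truncated compensator by the full linear term leaves this integral as an extra
    drift. Its integrand vanishes on the closed unit ball, so the first moment of the large jumps
    suffices. *)
Lemma large_jump_drift (nu : {measure set V -> \bar R}) (L C c : R) i :
  0 < L -> `|c| <= L ->
  (\int[nu]_(x in [set x : V | (1 <= enorm x)%R]) (enorm x ^+ 1)%:E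
     <= (C * c ^+ 1)%:E)%E ->
  let b (x : V) := x i ord0 / L * (1 - \1_[set y : V | enorm y <= 1] x) in
  nu.-integrable setT (EFin \o b) /\ `|\int[nu]_x b x| <= `|C|.
Proof.
move=> L0 cL H b; have [_ mB] := @measurable_jump_sizes R m.
set D := [set x : V | 1 <= enorm x] in mB H.
have mb : measurable [set y : V | enorm y <= 1].
  rewrite (_ : mkset _ = setT `&` @enorm R m @^-1` [set` `]-oo, 1]]).
    exact: measurable_enorm.
  by rewrite setTI; apply/seteqP; split=> x; rewrite /= in_itv.
apply: (@le_norm_Rintegral _ _ _ _ _ (fun x => enorm x / L * \1_D x)).
- apply: measurable_funM; first by apply: measurable_funM => //; exact: measurable_coord.
  by apply: measurable_funB => //; exact: measurable_indic.
- apply: measurable_funM; last exact: measurable_indic.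
  by apply: measurable_funM => //; exact: measurable_enorm.
- move=> x; rewrite /b !indicE normrM normrM normfV (gtr0_norm L0).
  have e0 := enorm_ge0 x.
  case: (leP (enorm x) 1) => x1.
    rewrite mem_set// subrr normr0 mulr0 mulr_ge0// divr_ge0// ltW//.
  rewrite memNset /=; last by apply/negP; rewrite -ltNge.
  rewrite mem_set; last exact: ltW.
  by rewrite subr0 normr1 !mulr1 ler_wpM2r ?invr_ge0 ?(ltW L0)//
      norm_coord_le_enorm.
- rewrite (_ : integral _ _ _ = (\int[nu]_(x in D) ((enorm x / L) ^+ 1)%:E)%E).
    exact: scaled_moment mB L0 cL H.
  rewrite [RHS]integral_mkcond; apply: eq_integral => x _.
  by rewrite patchE indicE expr1; case: (x \in D); rewrite ?mulr1 ?mulr0.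
Qed.

(** [B] is chosen before the law, the triplet and [L]. The real and imaginary parts of the rescaled
    exponent are expanded without constant term, then composed with [expR] and [cos] and
    multiplied. *)
Lemma approximable_charfun_coord k (C0 C1 : R) : (2 <= k)%N ->
  exists B, forall d (Omega : measurableType d) (P : probability Omega R)
    (X : {mfun Omega >-> V}) gamma Sigma (nu : {measure set V -> \bar R})
    (c0 c1 L : R) i,
  has_characteristic_triplet P X gamma Sigma nu ->
  (forall r : nat, (2 <= r <= k)%N ->
    (\int[nu]_(x in [set x : V | (enorm x < 1)%R]) (enorm x ^+ r)%:E
       <= (C0 * c0 ^+ r)%:E)%E) ->
  (forall r : nat, (1 <= r <= k)%N ->
    (\int[nu]_(x in [set x : V | (1 <= enorm x)%R]) (enorm x ^+ r)%:E
       <= (C1 * c1 ^+ r)%:E)%E) ->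
  0 < L -> enorm gamma <= L -> opnorm Sigma <= L ^+ 2 ->
  `|c0| <= L -> `|c1| <= L ->
  approximable k B (fun t => \int[P]_w cos (t * (X w i ord0 / L))).
Proof.
case: k => [//|[//|k]] k2.
have [p [p0 p1 tp]] := @taylor_cos_sub1 R k.
have [q [q0 q1 tq]] := @taylor_sin_subid R k.
have [e te] := @taylor_expR R k.+2.
have [[c tc] _] := @taylor_cos_sin R k.+2.
(* [M] bounds the rescaled moments of [nu]. Below, the real part adds 1 for the Gaussian term; the
   imaginary part adds 1 for gamma and |C1| for the large-jump drift. *)
pose M := `|C0| + `|C1|.
have [B1 HB1] := approximable_comp (1 + M) (ltn0Sn _) (@expR_ge0 R)
  (fun x y xy => etrans (ler_expR x y) xy) te.
have [B2 HB2] := approximable_comp ((1 + `|C1|) + M) (ltn0Sn _)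
  (fun=> ler01) (fun x y _ => lexx 1) tc.
have [B3 HB3] := approximableM k.+2 B1 B2.
exists B3 => d Omega P X gamma Sigma nu c0 c1 L i trip H0 H1 L0 gL SL c0L c1L.
pose a (x : V) := x i ord0 / L.
have ma : measurable_fun setT a.
  by apply: measurable_funM => //; exact: measurable_coord.
have aM r : (2 <= r <= k.+2)%N -> (\int[nu]_x (`|a x| ^+ r)%:E <= M%:E)%E.
  move=> rk; apply: coord_moment (H0 _ rk) (H1 _ _) => //.
  by case/andP: rk => /ltnW -> ->.
have mcos : measurable_fun setT (fun y : R => cos y - 1).
  by apply: measurable_funB => //; apply: continuous_measurable_fun;
    exact: continuous_cos.
have msin : measurable_fun setT (fun y : R => sin y - y).
  by apply: measurable_funB => //; apply: continuous_measurable_fun;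
    exact: continuous_sin.
have [_ [u1 u10 au1]] := approx_Rintegral (mu := nu) ma mcos aM k2 tp p0 p1.
have [isin [u2 u20 au2]] := approx_Rintegral (mu := nu) ma msin aM k2 tq q0 q1.
have [ib bC] := large_jump_drift i L0 c1L (H1 1%N isT).
set b := (fun x : V => _) in ib bC.
pose beta := \int[nu]_x b x.
have L20 : 0 < L ^+ 2 by rewrite exprn_gt0.
have [v1 v10 av1] : exists2 v : {poly R}, (2 != 0 :> nat -> v`_0 = 0) &
    poly_approx k.+2 1 (fun t => - (2^-1 * (Sigma i i / L ^+ 2)) * t ^+ 2) v.
  apply: poly_approx_monomial.
  have : `|Sigma i i / L ^+ 2| <= 1.
    rewrite normrM normfV (gtr0_norm L20) ler_pdivrMr// mul1r.
    exact: le_trans (norm_entry_le_opnorm _ _) SL.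
  move=> S1; rewrite normrN (normrM 2^-1) mulr_ile1//.
  by rewrite ger0_norm ?invr_ge0// invf_le1// ler1n.
have [v2 v20 av2] : exists2 v : {poly R}, (1 != 0 :> nat -> v`_0 = 0) &
    poly_approx k.+2 (1 + `|C1|) (fun t => (gamma i ord0 / L + beta) * t ^+ 1) v.
  apply: poly_approx_monomial.
  rewrite (le_trans (ler_normD _ _))// lerD//.
  rewrite normrM normfV (gtr0_norm L0) ler_pdivrMr// mul1r.
  exact: le_trans (norm_coord_le_enorm _ _) gL.
have re := HB1 _ _ (poly_approxD av1 au1) _.
have im := HB2 _ _ (poly_approxD av2 au2) _.
have := HB3 _ _ (re _) (im _).
rewrite !coefD v10// v20// u10 u20 addr0 => /(_ erefl erefl).
congr approximable; apply/funext => t /=.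
have -> : \int[P]_w cos (t * (X w i ord0 / L)) = \int[P]_w cos (t / L * X w i ord0).
  by apply: eq_Rintegral => w _; congr cos; rewrite mulrA mulrAC.
rewrite (charfun_coord i (t / L) trip); congr (expR _ * cos _).
  congr (_ + _); first by rewrite exprMn exprVn; field; rewrite gt_eqF.
  by apply: eq_Rintegral => x _; rewrite /a mulrA mulrAC.
rewrite mulrDl -addrA expr1; congr (_ + _); first by field; rewrite gt_eqF.
(* With y = t x_i / L, the compensated sine splits as (sin y - y) + t b(x), both summands being
   integrable. *)
rewrite mulrC /beta -RintegralZl// -RintegralD//; last first.
  by have := integrableZl measurableT t ib.
apply: eq_Rintegral => x _; rewrite /b /a.
have -> : t / L * x i ord0 = t * (x i ord0 / L) by rewrite mulrA mulrAC.
by ring.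
Qed.

End characteristic_function_expansion.

(** * From coordinate moments to the norm *)

Lemma opnorm_ge0 (R : realType) m n (A : 'M[R]_(m, n)) : 0 <= opnorm A.
Proof.
apply: le_trans (enorm_ge0 (A *m 0)) (le_opnorm _ _).
by rewrite /enorm /dot big1 ?sqrtr0// => i _; rewrite mxE mul0r.
Qed.

Theorem lemma2p2 (R : realType) (m k : nat) (hk0 : (0 < k)%N)
    (hkeven : ~~ odd k) (C0 C1 : R) :
  exists C : R, 0 < C /\
    forall (d : measure_display) (Omega : measurableType d)
      (P : probability Omega R) (X : {mfun Omega >-> 'cV[R]_m})
      (gamma : 'cV[R]_m) (Sigma : 'M[R]_m)
      (nu : {measure set 'cV[R]_m -> \bar R}) (c0 c1 : R),
    infinitely_divisible P X ->
    has_characteristic_triplet P X gamma Sigma nu ->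
    (forall r : nat, (2 <= r <= k)%N ->
      (\int[nu]_(x in [set x : 'cV[R]_m | (enorm x < 1)%R])
          (enorm x ^+ r)%:E <= (C0 * c0 ^+ r)%:E)%E) ->
    (forall r : nat, (1 <= r <= k)%N ->
      (\int[nu]_(x in [set x : 'cV[R]_m | (1 <= enorm x)%R])
          (enorm x ^+ r)%:E <= (C1 * c1 ^+ r)%:E)%E) ->
    ('E_P[fun w => (enorm (X w) ^+ k)%R]
      <= (C * (enorm gamma ^+ k + opnorm Sigma ^+ k./2
               + c0 ^+ k + c1 ^+ k))%:E)%E.
Proof.
have k2 : (2 <= k)%N by case: k hk0 hkeven => [|[]].
have [h hkE] : exists h, k = h.*2 by exists k./2; rewrite even_halfK.
have h0 : (0 < h)%N by rewrite -double_gt0 -hkE.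
have kh : k./2 = h by rewrite hkE doubleK.
have [B HB] := @approximable_charfun_coord R m k C0 C1 k2.
rewrite kh.
pose K := 16 ^+ h * (B * h%:R ^+ h.*2).
(* The factor m^h comes from comparing the norm with the coordinates, m |K| from summing over them,
   and the added 1 gives positivity even for m = 0. *)
pose C := m%:R ^+ h * (m%:R * `|K|) + 1.
have C_gt0 : 0 < C by rewrite ltr_wpDl// mulr_ge0 ?exprn_ge0// mulr_ge0.
exists C; split=> // d Omega P X gamma Sigma nu c0 c1 _ trip H0 H1.
have even_ge0 (x : R) : 0 <= x ^+ k by rewrite hkE -mul2n exprM exprn_ge0// sqr_ge0.
set S := _ + c1 ^+ k.
have gk0 : 0 <= enorm gamma ^+ k := even_ge0 _.
have Sk0 : 0 <= opnorm Sigma ^+ h by rewrite exprn_ge0// opnorm_ge0.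
have c0k := even_ge0 c0; have c1k := even_ge0 c1.
have S0 : 0 <= S by rewrite /S !addr_ge0.
apply/lee_addgt0Pr => eps eps0.
(* The term eps / C keeps [L] positive when [S] is 0, and costs exactly [eps] after multiplication
   by [C]. *)
pose L := (S + eps / C) `^ (k%:R^-1).
have SC0 : 0 < S + eps / C by rewrite ltr_wpDl// divr_gt0.
have L0 : 0 < L by rewrite powR_gt0.
have Lk : L ^+ k = S + eps / C.
  rewrite -powR_mulrn ?(ltW L0)// -powRrM mulVf ?powRr1 ?(ltW SC0)//.
  by rewrite pnatr_eq0 -lt0n.
have SL : S <= L ^+ k by rewrite Lk lerDl divr_ge0// ltW.
have le_root (x : R) : 0 <= x -> x ^+ k <= S -> x <= L.
  move=> x0 xS; rewrite -(ler_pXn2r hk0) ?nnegrE ?(ltW L0)//.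
  exact: le_trans SL.
have normk (x : R) : `|x| ^+ k = x ^+ k by rewrite -normrX ger0_norm.
have gL : enorm gamma <= L.
  by apply: le_root; [exact: enorm_ge0|rewrite /S; lra].
have sL : opnorm Sigma <= L ^+ 2.
  rewrite -(ler_pXn2r h0) ?nnegrE ?opnorm_ge0 ?exprn_ge0 ?(ltW L0)//.
  rewrite -exprM mul2n -hkE; apply: le_trans SL; rewrite /S; lra.
have c0L : `|c0| <= L by apply: le_root => //; rewrite normk /S; lra.
have c1L : `|c1| <= L by apply: le_root => //; rewrite normk /S; lra.
have mX i : measurable_fun setT (fun w => X w i ord0).
  exact: measurableT_comp (measurable_coord i) (measurable_funPT X).
have mXk i : measurable_fun setT (fun w => (X w i ord0 ^+ k)%:E).
  by apply/measurable_EFinP; exact: measurable_funX.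
have coord i : (\int[P]_w (X w i ord0 ^+ k)%:E <= (`|K| * L ^+ k)%:E)%E.
  have := HB _ _ _ _ _ _ _ _ _ _ i trip H0 H1 L0 gL sL c0L c1L.
  rewrite {1}hkE => /even_moment_bound.
  rewrite -hkE -/K => /(_ (measurable_funM (mX i) (measurable_cst _))) KE.
  have mXL : measurable_fun setT (fun w => ((X w i ord0 / L) ^+ k)%:E).
    by apply/measurable_EFinP/measurable_funX/measurable_funM.
  (* [KE] bounds the k-th moment of the coordinate divided by [L]; the factor L^k is restored
     here. *)
  rewrite (_ : integral _ _ _ =
      ((L ^+ k)%:E * \int[P]_w ((X w i ord0 / L) ^+ k)%:E)%E); last first.
    rewrite -ge0_integralZl_EFin//; first last.
    - by move=> w _; rewrite lee_fin.
    apply: eq_integral => w _; rewrite -EFinM -exprMn mulrC divfK//.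
    by rewrite gt_eqF.
  rewrite mulrC EFinM lee_wpmul2l ?lee_fin ?exprn_ge0 ?(ltW L0)//.
  by rewrite (le_trans KE)// /K -hkE lee_fin ler_norm.
have mS : measurable_fun setT (fun w => \sum_(i < m) (X w i ord0 ^+ k)%:E)%E.
  by apply: emeasurable_sum => i; exact: mXk.
rewrite unlock.
apply: (@le_trans _ _ (\int[P]_w ((m%:R ^+ h)%:E * \sum_(i < m) (X w i ord0 ^+ k)%:E))%E).
  apply: ge0_le_integral => //.
  - by move=> w _; rewrite lee_fin.
  - apply/measurable_EFinP; apply: measurable_funX.
    exact: measurableT_comp (@measurable_enorm R m) (measurable_funPT X).
  - exact: measurable_funeM.
  - move=> w _; rewrite sumEFin -EFinM lee_fin hkE.
    exact: enorm_even_power_le.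
rewrite ge0_integralZl_EFin//; first last.
- by move=> w _; rewrite sume_ge0// => i _; rewrite lee_fin.
rewrite ge0_integral_sum//; last by move=> i w _; rewrite lee_fin.
apply: (@le_trans _ _ ((m%:R ^+ h)%:E * \sum_(i < m) (`|K| * L ^+ k)%:E)%E).
  by rewrite lee_wpmul2l ?lee_fin ?exprn_ge0//; apply: lee_sum => i _.
rewrite sumEFin sumr_const card_ord -EFinM -EFinD lee_fin -[(_ * _) *+ m]mulr_natl.
apply: (@le_trans _ _ (C * L ^+ k)).
  by rewrite /C mulrDl mul1r -!mulrA lerDl exprn_ge0// ltW.
by rewrite Lk mulrDr (mulrC C (eps / C)) divfK// gt_eqF.
Qed.
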